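(* Let $n\ge k\ge 0$ be integers and let $\mathcal{F}\subset\binom{[n]}{k}$ be an increasing family. (i) If $n$ is even and Alice wins her $\mathcal{F}$-game, then Bob wins his $\mathcal{F}$-game. (ii) If $n$ is odd and Bob wins his $\mathcal{F}$-game, then Alice wins her $\mathcal{F}$-game.
   Context: Here $[n]=\{1,\dots,n\}$ and $\binom{[n]}{k}$ is the family of all $k$-element subsets of $[n]$. Increasing families: a family $\mathcal{F}\subset\binom{[n]}{k}$ is (pointwise-)increasing if it is closed upwards in the pointwise order, in which $\{s_1<\cdots<s_k\}\preceq\{t_1<\cdots<t_k\}$ if and only if $s_i\le t_i$ for all $i\in[k]$. That is, if $S\in\mathcal{F}$, $T\in\binom{[n]}{k}$ and $S\preceq T$, then $T\in\mathcal{F}$. Picker--chooser games: with a family $\mathcal{F}\subset\binom{[n]}{k}$ one associates two perfect-information games between Alice and Bob on the board $[n]$. In each game one player is the protagonist and the other the antagonist: in Alice's $\mathcal{F}$-game Alice is the protagonist, and in Bob's $\mathcal{F}$-game Bob is the protagonist. In both games the mechanics are as follows. On each turn, one player is the picker and the other is the chooser; the picker names an element still on the board, and the chooser takes that element off the board and decides which of the two players receives it. In both games, Alice is the picker and Bob is the chooser on the first turn, and the roles of picker and chooser alternate after each turn. The game stops as soon as either the protagonist has $k$ elements or the antagonist has $n-k$ elements, at which point the other player receives all remaining elements (if $k=0$ or $k=n$ the game is over at the start). At the end, the protagonist holds a $k$-set and the antagonist an $(n-k)$-set. The protagonist wins if their final $k$-set lies in $\mathcal{F}$. ''Alice wins her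 $\mathcal{F}$-game'' means that Alice has a winning strategy in Alice's $\mathcal{F}$-game, and ''Bob wins his $\mathcal{F}$-game'' means that Bob has a winning strategy in Bob's $\mathcal{F}$-game. *)

(* Defs.v *)
From HB Require Import structures.
From mathcomp Require Import all_boot.

Set Implicit Arguments.
Unset Strict Implicit.
Unset Printing Implicit Defensive.

(* The board [n] = {1, ..., n} is represented by 'I_n = {0, ..., n-1}; only the
   order of its elements matters. *)

Lemma enum_set_sorted (n : nat) (S : {set 'I_n}) :
  sorted ltn [seq val i | i <- enum S].
Proof.
rewrite /enum_mem -enumT /=.
apply: (subseq_sorted ltn_trans (s2 := [seq val i | i <- enum 'I_n])).
  exact/map_subseq/filter_subseq.
by rewrite val_enum_ord iota_ltn_sorted.
Qed.

(* By enum_set_sorted, enum S and enum T list S and T in increasing order;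
   all2 also requires that they have the same size. *)
Definition pointwise_le (n : nat) (S T : {set 'I_n}) : bool :=
  all2 (fun s t : 'I_n => s <= t) (enum S) (enum T).

Definition increasing (n k : nat) (F : {set {set 'I_n}}) : Prop :=
  forall S T : {set 'I_n},
    S \in F -> #|T| = k -> pointwise_le S T -> T \in F.

Variant player := Alice | Bob.

Definition is_Alice (p : player) : bool := if p is Alice then true else false.
Definition player_of_bool (b : bool) : player := if b then Alice else Bob.
Lemma is_AliceK : cancel is_Alice player_of_bool.
Proof. by case. Qed.

HB.instance Definition _ := Equality.copy player (can_type is_AliceK).

Definition opponent (p : player) : player := if p is Alice then Bob else Alice.

(* A history lists the turns played so far, most recent first; (x, r) records
   that x was named by the picker and given to r by the chooser. *)
Definition history (n : nat) := seq ('I_n * player).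

Definition held (n : nat) (p : player) (h : history n) : {set 'I_n} :=
  [set x | (x, p) \in h].

Definition on_board (n : nat) (h : history n) (x : 'I_n) : bool :=
  x \notin unzip1 h.

Definition picker (n : nat) (h : history n) : player :=
  if odd (size h) then Bob else Alice.

(* Below, p is the protagonist. *)
Definition game_over (n k : nat) (p : player) (h : history n) : bool :=
  (#|held p h| == k) || (#|held (opponent p) h| == n - k).

(* In the second case the antagonist has n - k elements and the protagonist
   receives everything else. *)
Definition final_set (n k : nat) (p : player) (h : history n) : {set 'I_n} :=
  if #|held p h| == k then held p h else ~: held (opponent p) h.

(* The value of pick is an option because the board is empty if n = 0. *)
Record strategy (n : nat) := Strategy {
  pick : history n -> option 'I_n;
  choose : history n -> 'I_n -> player
}.

(* The histories that can arise when p follows the strategy s and the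
   opponent plays arbitrarily. *)
Inductive consistent (n k : nat) (p : player) (s : strategy n) :
    history n -> Prop :=
| consistent_start : consistent k p s [::]
| consistent_picker (h : history n) (x : 'I_n) (r : player) :
    consistent k p s h -> ~~ game_over k p h -> picker h = p ->
    on_board h x -> pick s h = Some x -> consistent k p s ((x, r) :: h)
| consistent_chooser (h : history n) (x : 'I_n) :
    consistent k p s h -> ~~ game_over k p h -> picker h = opponent p ->
    on_board h x -> consistent k p s ((x, choose s h x) :: h).

(* p never gets stuck: whenever p has to pick, s names an element that is still
   on the board. *)
Definition legal (n k : nat) (p : player) (s : strategy n) : Prop :=
  forall h : history n,
    consistent k p s h -> ~~ game_over k p h -> picker h = p ->
    exists2 x, pick s h = Some x & on_board h x.

Definition winning (n k : nat) (F : {set {set 'I_n}}) (p : player)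
    (s : strategy n) : Prop :=
  legal k p s /\
  forall h : history n,
    consistent k p s h -> game_over k p h -> final_set k p h \in F.

Definition wins_own_game (n k : nat) (F : {set {set 'I_n}}) (p : player) :
    Prop :=
  exists s : strategy n, winning k F p s.

(* Main.v *)
Require Import Defs.
From mathcomp Require Import all_boot.
From mathcomp Require Import zify.

(** A position is a pair (B, S), where B is the set of elements still on the
    board and S the set already held by the protagonist.  The future turns are
    recorded in a word l of booleans, a letter being true when the protagonist
    is the picker (P below) and false when the antagonist is (A below).  A word
    has one letter less than there are elements on the board, because the game
    is over once a single element is left.  [win l B S] says that the
    protagonist wins from (B, S), and [wins_own_gameE] identifies the two games
    of the theorem with the two alternating words on the full board.

    Since the family is increasing, receiving a larger element x, or losing a
    smaller one, is better for the protagonist ([win_give_up],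
    [win_refuse_down]).

    The heart of the matter is the case of an odd board ([win_swap_picker]).
    Let m be even and suppose that the protagonist wins on m + 1 elements when
    the antagonist picks first, the word being l = AP...AP.  To win with the
    word PA...PA, let the protagonist first pick the median x of the board.
    Whatever becomes of x, the protagonist then plays a simulated game with the
    word l in which x is still on the board.  The word of the real game is now
    l without its last letter, so the same player picks in both games, and the
    protagonist copies the moves of the simulated game.  When the simulated
    strategy picks an element y:
    - if x was received and y > x, or x was lost and y < x, then y is picked in
      the real game as well;
    - if x was received and y <= x, replace the simulated game by the one in
      which y has just been received.  By monotonicity the protagonist also
      wins if x is received instead of y, so the real position is won with the
      remaining word AP...AP; by induction it is then won with the word
      PA...PA of the same length, which is the one of the real game.  The case
      where x was lost and y >= x is symmetric.

    The position of x matters only when a single element is left to receive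
    (or to lose) in the simulated game: then x itself is the last element of
    the real final set (or of its complement), and must be good enough.  With
    one element left to receive and i letters A left in the word, every element
    with at least i smaller elements on the board is good ([win_one_left]), and
    symmetrically for one element left to lose ([win_one_short]).  For a
    received x, the number of smaller elements drops by at most one on a turn
    where the antagonist picks, which uses up one letter A, and is unchanged on
    a turn where the protagonist picks a larger element; so the required
    inequality persists.  It holds at the start for both outcomes of the first
    turn because l has as many letters A as letters P, so that the median has
    enough elements on both sides.  This simulation is [simulationP].

    The case of an even board ([win_swap_chooser]) follows.  If the protagonist
    wins by picking x first, then both outcomes lead to odd boards on which the
    roles may be exchanged.  If the antagonist picks y first instead, the
    protagonist takes y when y >= x and refuses it when y < x, and is at least
    as well off as after the same outcome for x. *)

Set Implicit Arguments.
Unset Strict Implicit.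
Unset Printing Implicit Defensive.

(** * Alternating words *)

(** The word of length m whose letters alternate, beginning with b. *)
Fixpoint alternating (b : bool) (m : nat) : seq bool :=
  if m is m'.+1 then b :: alternating (~~ b) m' else [::].

(** The word alternating (odd m) m is the one of length m ending with true. *)
Lemma count_alternating (m : nat) :
  count negb (alternating (odd m) m) = m./2.
Proof.
elim: m => // m IHm /=.
by rewrite negbK IHm uphalf_half; case: (odd m).
Qed.

(** * Winning positions *)

Lemma setU1D1C (T : finType) (B : {set T}) (x y : T) :
  x != y -> x \notin B -> (x |: B) :\ y = x |: B :\ y.
Proof.
move=> xy xB; apply/setP => z; rewrite !inE.
by have [->|] := eqVneq z x; rewrite ?xy.
Qed.

Section Game.

Variables (n k : nat) (F : {set {set 'I_n}}).
Implicit Types (B S : {set 'I_n}) (x y z : 'I_n) (l : seq bool).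

(** The protagonist wins from the position (B, S) when the pickers of the
    coming turns are given by l.  The two tests say that the game is over: the
    protagonist has k elements, or must receive all of B.  A word too short for
    the board to be settled counts as a loss. *)
Fixpoint win l B S : bool :=
  if #|S| == k then S \in F
  else if #|S| + #|B| == k then S :|: B \in F
  else if l is b :: l' then
    if b then [exists x in B, win l' (B :\ x) (x |: S) && win l' (B :\ x) S]
    else [forall x in B, win l' (B :\ x) (x |: S) || win l' (B :\ x) S]
  else false.

(** The numbers of elements of the board on either side of x. *)
Definition below B x : nat := #|[set z in B | z < x]|.
Definition above B x : nat := #|[set z in B | x < z]|.

Lemma belowD1_ge B x y : below B x <= (below (B :\ y) x).+1.
Proof.
rewrite /below (cardsD1 y [set z in B | z < x]).
have -> : [set z in B | z < x] :\ y = [set z in B :\ y | z < x].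
  by apply/setP => z; rewrite !inE andbA.
by case: (y \in _).
Qed.

Lemma belowD1_up B x y : x <= y -> below (B :\ y) x = below B x.
Proof.
move=> xy; apply: eq_card => z; rewrite !inE.
by case: eqVneq => //= ->; rewrite ltnNge xy andbF.
Qed.

Lemma aboveD1_ge B x y : above B x <= (above (B :\ y) x).+1.
Proof.
rewrite /above (cardsD1 y [set z in B | x < z]).
have -> : [set z in B | x < z] :\ y = [set z in B :\ y | x < z].
  by apply/setP => z; rewrite !inE andbA.
by case: (y \in _).
Qed.

Lemma aboveD1_down B x y : y <= x -> above (B :\ y) x = above B x.
Proof.
move=> yx; apply: eq_card => z; rewrite !inE.
by case: eqVneq => //= ->; rewrite ltnNge yx andbF.
Qed.

Lemma below_above B x : x \in B -> (below B x + above B x).+1 = #|B|.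
Proof.
move=> xB; rewrite (cardsD1 x B) xB add1n; congr _.+1.
have disj : [set z in B | z < x] :&: [set z in B | x < z] = set0.
  by apply/setP => z; rewrite !inE; case: ltngtP; rewrite ?andbF.
rewrite /below /above -cardsUI disj cards0 addn0; apply: eq_card => z.
rewrite !inE -andb_orr -neq_ltn andbC.
by congr (_ && _).
Qed.

Lemma ex_below B (i : nat) : i < #|B| -> exists2 x, x \in B & below B x = i.
Proof.
have [m] := ubnP #|B|; elim: m B => // m IHm B ltBm ltiB.
have [x0 x0B] : exists x, x \in B by apply/card_gt0P; apply: leq_trans ltiB.
(* The largest element of B has the largest rank; the others keep their rank
   when it is removed. *)
case: (arg_maxnP val x0B) => M; rewrite -/(M \in B) => MB Mmax.
have cB : #|B| = #|B :\ M|.+1 by rewrite (cardsD1 M B) MB.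
have := ltiB; rewrite cB ltnS leq_eqVlt => /predU1P[->|ltiB'].
  exists M => //; apply: eq_card => z; rewrite !inE andbC ltn_neqAle.
  by case: (boolP (z \in B)) => [/Mmax /= ->|]; rewrite ?andbF ?andbT.
have [|x xB <-] := IHm (B :\ M) _ ltiB'; first by rewrite -ltnS -cB.
have xB' : x \in B by case/setD1P: xB.
by exists x => //; rewrite belowD1_up //; apply: Mmax.
Qed.

Lemma ex_median B (j : nat) : #|B| = j.*2.+1 ->
  exists x, [/\ x \in B, below B x = j & above B x = j].
Proof.
move=> cB; have [|x xB bx] := @ex_below B j; first by rewrite cB; lia.
by exists x; split=> //; have := below_above xB; rewrite bx cB; lia.
Qed.

(** * Monotonicity *)

(** The only consequence of F being increasing that is needed: replacing an
    element by a larger one keeps a set in F. *)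
Hypothesis exch : forall S x y, x < y -> x \notin S -> y \notin S ->
  x |: S \in F -> y |: S \in F.

Lemma win_held_up l B S x y : x < y ->
  x \notin B -> y \notin B -> x \notin S -> y \notin S ->
  win l B (x |: S) -> win l B (y |: S).
Proof.
move=> xy; elim: l B S => [|b l IHl] B S xB yB xS yS /=.
all: rewrite !cardsU1 xS yS; case: ifP => _; first exact: exch.
all: case: ifP => _.
1,3: by rewrite -!setUA; apply: exch; rewrite ?inE ?negb_or ?xS ?yS.
  by [].
(* The move in which z is picked, r telling whether the protagonist gets it. *)
have step z r : z \in B ->
    win l (B :\ z) (if r then z |: (x |: S) else x |: S) ->
    win l (B :\ z) (if r then z |: (y |: S) else y |: S).
  move=> zB; have zx : x != z by apply: contraNneq xB => ->.
  have zy : y != z by apply: contraNneq yB => ->.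
  case: r; rewrite 1?(setUCA [set z]) 1?(setUCA [set z] [set y]); apply: IHl;
    by rewrite ?inE ?negb_or ?xB ?yB ?andbF ?zx ?zy.
case: b.
  case/exists_inP => z zB /andP[w1 w2]; apply/exists_inP; exists z => //.
  by rewrite (step z true zB w1) (step z false zB w2).
move/forall_inP => h; apply/forall_inP => z zB.
by case/orP: (h z zB) => [/(step z true zB)|/(step z false zB)] ->;
  rewrite ?orbT.
Qed.

(** Receiving y and leaving x on the board is better than the converse when
    x < y; an opponent picking x is answered as if y had been picked. *)
Lemma win_swap_up l B S x y : x < y ->
  x \notin B -> y \notin B -> x \notin S -> y \notin S ->
  win l (y |: B) (x |: S) -> win l (x |: B) (y |: S).
Proof.
move=> xy; have ltxy: x != y by rewrite neq_ltn xy.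
elim: l B S => [|b l IHl] B S xB yB xS yS /=.
all: rewrite !cardsU1 xS yS xB yB; case: ifP => _; first exact: exch.
all: have -> : y |: S :|: (x |: B) = x |: S :|: (y |: B)
  by rewrite setUACA [X in X :|: _]setUC -setUACA.
all: case: ifP => _ //.
have step z r : z \in B ->
    win l ((y |: B) :\ z) (if r then z |: (x |: S) else x |: S) ->
    win l ((x |: B) :\ z) (if r then z |: (y |: S) else y |: S).
  move=> zB; have zx : x != z by apply: contraNneq xB => ->.
  have zy : y != z by apply: contraNneq yB => ->.
  rewrite !setU1D1C //.
  case: r; rewrite 1?(setUCA [set z]) 1?(setUCA [set z] [set y]); apply: IHl;
    by rewrite ?inE ?negb_or ?xB ?yB ?andbF ?zx ?zy.
(* Picking x in one position corresponds to picking y in the other. *)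
have stepx r :
    win l ((y |: B) :\ y) (if r then y |: (x |: S) else x |: S) ->
    win l ((x |: B) :\ x) (if r then x |: (y |: S) else y |: S).
  rewrite !setU1K //; case: r; first by rewrite setUCA.
  exact: win_held_up.
case: b.
  case/exists_inP => z; rewrite in_setU1 => /predU1P[->|zB] /andP[w1 w2];
  apply/exists_inP.
    exists x; first by rewrite setU11.
    by rewrite (stepx true w1) (stepx false w2).
  exists z; first by rewrite in_setU1 zB orbT.
  by rewrite (step z true zB w1) (step z false zB w2).
move/forall_inP => h; apply/forall_inP => z.
rewrite in_setU1 => /predU1P[->|zB].
  by case/orP: (h y (setU11 _ _)) => [/(stepx true)|/(stepx false)] ->;
    rewrite ?orbT.
have zyB : z \in y |: B by rewrite in_setU1 zB orbT.
by case/orP: (h z zyB) => [/(step z true zB)|/(step z false zB)] ->;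
  rewrite ?orbT.
Qed.

(** A larger element on the board is better for the protagonist. *)
Lemma win_board_up l B S x y : x < y ->
  x \notin B -> y \notin B -> x \notin S -> y \notin S ->
  win l (x |: B) S -> win l (y |: B) S.
Proof.
move=> xy; elim: l B S => [|b l IHl] B S xB yB xS yS /=.
all: rewrite !cardsU1 xB yB; case: ifP => _ //; case: ifP => _ //.
1,2: by rewrite !(setUCA S); apply: exch; rewrite ?inE ?negb_or ?xS ?yS.
have step z r : z \in B ->
    win l ((x |: B) :\ z) (if r then z |: S else S) ->
    win l ((y |: B) :\ z) (if r then z |: S else S).
  move=> zB; have zx : x != z by apply: contraNneq xB => ->.
  have zy : y != z by apply: contraNneq yB => ->.
  rewrite !setU1D1C //.
  case: r; apply: IHl;
    by rewrite ?inE ?negb_or ?xB ?yB ?andbF ?zx ?zy.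
have stepx r :
    win l ((x |: B) :\ x) (if r then x |: S else S) ->
    win l ((y |: B) :\ y) (if r then y |: S else S).
  by rewrite !setU1K //; case: r => //; apply: win_held_up.
case: b.
  case/exists_inP => z; rewrite in_setU1 => /predU1P[->|zB] /andP[w1 w2];
  apply/exists_inP.
    exists y; first by rewrite setU11.
    by rewrite (stepx true w1) (stepx false w2).
  exists z; first by rewrite in_setU1 zB orbT.
  by rewrite (step z true zB w1) (step z false zB w2).
move/forall_inP => h; apply/forall_inP => z.
rewrite in_setU1 => /predU1P[->|zB].
  by case/orP: (h x (setU11 _ _)) => [/(stepx true)|/(stepx false)] ->;
    rewrite ?orbT.
have zxB : z \in x |: B by rewrite in_setU1 zB orbT.
by case/orP: (h z zxB) => [/(step z true zB)|/(step z false zB)] ->;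
  rewrite ?orbT.
Qed.


(** * One element left to receive, or to lose *)

(** If one element is left to receive, every element of sufficient rank will
    do.  When the antagonist picks, the case where a smaller element y is
    picked is enough: either y is good, hence x too, or y leaves the board and
    the bound on the rank of x is preserved. *)
Lemma win_one_left l B S x : #|S|.+1 = k -> [disjoint B & S] -> x \in B ->
  win l B S -> count negb l <= below B x -> x |: S \in F.
Proof.
move=> kS; elim: l B => [|b l IHl] B dBS xB /=.
all: rewrite ifN; last by rewrite -kS neq_ltn ltnSn.
all: have nS z : z \in B -> z \notin S
  by move=> zB; rewrite (disjointFr dBS zB).
all: have -> : (#|S| + #|B| == k) = (#|B| == 1) by rewrite -kS -addn1 eqn_add2l.
all: case: ifP => [/cards1P[y BE]|_] //.
1,2: by move: xB; rewrite BE inE setUC => /eqP ->.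
have dD z : [disjoint B :\ z & S].
  by apply: disjointWl dBS; rewrite subsetDl.
have winS z : z \in B -> win l (B :\ z) (z |: S) -> z |: S \in F.
  move=> zB; have kz : #|z |: S| == k by rewrite cardsU1 nS // -kS.
  by case: (l) => [|? ?] /=; rewrite kz.
case: b => /=.
  case/exists_inP => y yB /andP[/(winS _ yB) wy]; rewrite add0n => w2 cl.
  case: (ltngtP y x) => [yx|xy|/val_inj <- //].
    by apply: exch wy; rewrite ?nS.
  apply: IHl w2 _; rewrite ?belowD1_up ?(ltnW xy) //.
  by rewrite !inE xB neq_ltn xy.
move/forall_inP => h; rewrite add1n => cl.
have /card_gt0P[y] : 0 < below B x by apply: leq_trans cl.
rewrite inE => /andP[yB yx].
case/orP: (h y yB) => [/(winS _ yB) wy|w2].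
  by apply: exch wy; rewrite ?nS.
apply: IHl w2 _ => //; first by rewrite !inE xB neq_ltn yx orbT.
by rewrite -ltnS (leq_trans cl) // belowD1_ge.
Qed.

(** The symmetric fact when one element is left to lose: again the turns that
    count are those on which the antagonist picks. *)
Lemma win_one_short l B S x : k.+1 = #|S| + #|B| -> [disjoint B & S] ->
  x \in B -> win l B S -> count negb l <= above B x -> S :|: B :\ x \in F.
Proof.
elim: l B S => [|b l IHl] B S kS dBS xB /=.
all: have nS z : z \in B -> z \notin S
  by move=> zB; rewrite (disjointFr dBS zB).
all: case: ifP => [/eqP Sk|Sk].
1,3: have /cards1P[y BE] : #|B| == 1
  by rewrite -(eqn_add2l #|S|) -kS -Sk addn1.
1,2: by move: xB; rewrite BE inE => /eqP ->; rewrite setDv setU0.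
all: rewrite ifN //; last by rewrite -kS neq_ltn ltnSn orbT.
have dD z : [disjoint B :\ z & S].
  by apply: disjointWl dBS; rewrite subsetDl.
have cD z : z \in B -> #|S| + #|B :\ z| = k.
  by move=> zB; apply/succn_inj; rewrite kS (cardsD1 z B) zB add1n addnS.
have winB z : z \in B -> win l (B :\ z) S -> S :|: B :\ z \in F.
  by move=> zB; case: (l) => [|? ?] /=; rewrite cD // eqxx Sk.
have up y : y \in B -> x < y -> S :|: B :\ y \in F -> S :|: B :\ x \in F.
  move=> yB xy; have nxy : x != y by rewrite neq_ltn xy.
  rewrite -(@setD1K _ x (B :\ y)); last by rewrite !inE nxy.
  rewrite -(@setD1K _ y (B :\ x)); last by rewrite !inE eq_sym nxy.
  rewrite !(setUCA S) !setDDl [[set y] :|: _]setUC; apply: exch => //.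
    by rewrite !inE eqxx negb_or nS ?orbT.
  by rewrite !inE eqxx negb_or nS ?orbT.
have down y : y \in B -> y != x -> win l (B :\ y) (y |: S) ->
    count negb l <= above (B :\ y) x -> S :|: B :\ x \in F.
  move=> yB nyx w2 cl.
  have -> : S :|: B :\ x = y |: S :|: B :\ y :\ x.
    rewrite -(@setD1K _ y (B :\ x)); last by rewrite !inE nyx.
    by rewrite setUCA setUA !setDDl [[set x] :|: _]setUC.
  apply: IHl w2 cl.
  - by rewrite cardsU1 nS // -(cD y yB).
  - rewrite disjoints_subset; apply/subsetP => z; rewrite !inE => /andP[zy zB].
    by rewrite negb_or zy nS.
  - by rewrite !inE eq_sym nyx.
case: b => /=.
  case/exists_inP => y yB /andP[w1 /(winB _ yB) wy]; rewrite add0n => cl.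
  case: (ltngtP y x) => [yx|xy|/val_inj <- //]; last exact: up wy.
  by apply: down w1 _ => //; rewrite ?aboveD1_down ?(ltnW yx) // neq_ltn yx.
move/forall_inP => h; rewrite add1n => cl.
have /card_gt0P[y] : 0 < above B x by apply: leq_trans cl.
rewrite inE => /andP[yB xy].
case/orP: (h y yB) => [w1|/(winB _ yB)]; last exact: up.
apply: down w1 _ => //; first by rewrite neq_ltn xy orbT.
by rewrite -ltnS (leq_trans cl) // aboveD1_ge.
Qed.


(** * Live positions *)

(** The positions that occur in a game: the protagonist holds at most k
    elements and can still reach k. *)
Definition live B S : bool := [disjoint B & S] && (#|S| <= k <= #|S| + #|B|).

Lemma live_give B S z : z \in B -> live B S -> #|S| < k ->
  live (B :\ z) (z |: S).
Proof.
move=> zB /andP[dBS /andP[_ kB]] Sk.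
have zS : z \notin S by rewrite (disjointFr dBS zB).
apply/andP; split.
  rewrite disjoints_subset; apply/subsetP => y; rewrite !inE => /andP[yz yB].
  by rewrite negb_or yz (disjointFr dBS yB).
by move: kB; rewrite cardsU1 zS (cardsD1 z B) zB Sk addnCA addnA.
Qed.

Lemma live_refuse B S z : z \in B -> live B S -> k < #|S| + #|B| ->
  live (B :\ z) S.
Proof.
move=> zB /andP[dBS /andP[Sk _]] kB; apply/andP; split.
  by apply: disjointWl dBS; rewrite subsetDl.
by move: kB; rewrite Sk (cardsD1 z B) zB addnCA add1n ltnS.
Qed.

Lemma win_overl l B S : #|S| = k -> win l B S = (S \in F).
Proof. by case: l => [|? ?] /= ->; rewrite eqxx. Qed.

Lemma win_overr l B S : #|S| + #|B| = k -> [disjoint B & S] ->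
  win l B S = (S :|: B \in F).
Proof.
move=> SB dBS; have eqS : #|S| = k -> S :|: B = S.
  move=> Sk; suff -> : B = set0 by rewrite setU0.
  by apply: cards0_eq; apply/eqP; rewrite -(eqn_add2l #|S|) SB Sk addn0.
by case: l => [|? ?] /=; case: eqP => [/eqS ->|_]; rewrite ?SB ?eqxx.
Qed.

Lemma win_ongoing b l B S : #|S| < k -> k < #|S| + #|B| ->
  win (b :: l) B S =
    if b then [exists x in B, win l (B :\ x) (x |: S) && win l (B :\ x) S]
    else [forall x in B, win l (B :\ x) (x |: S) || win l (B :\ x) S].
Proof. by move=> Sk kB /=; rewrite (ltn_eqF Sk) (gtn_eqF kB). Qed.

(** A live position is decided because the protagonist has k elements or must
    receive all the others, or the game goes on. *)
Variant stage_spec B S : Prop :=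
| StageFull of #|S| = k
| StageAll of #|S| + #|B| = k
| StageOngoing of #|S| < k & k < #|S| + #|B|.

Lemma stageP B S : live B S -> stage_spec B S.
Proof.
case/and3P=> _; rewrite leq_eqVlt => /predU1P[Sk|Sk].
  by move=> _; exact: StageFull.
by rewrite leq_eqVlt => /predU1P[kB|kB]; [exact: StageAll|exact: StageOngoing].
Qed.

(** * Exchanging the picker and the chooser *)

(** The simulation, for boards of m + 1 elements: if the protagonist wins the
    game with x on the board, the word ending with true, then the protagonist
    also wins the game without x and without the last letter, whether x has been
    received or lost, provided that x has enough elements on the relevant
    side. *)
Definition simulation (m : nat) : Prop := forall B S, live B S ->
  #|B| = m.+1 -> win (alternating (odd m) m) B S -> forall x, x \in B ->
  (#|S| < k -> m./2 <= below B x ->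
     win (alternating (odd m) m.-1) (B :\ x) (x |: S)) /\
  (k < #|S| + #|B| -> m./2 <= above B x ->
     win (alternating (odd m) m.-1) (B :\ x) S).

(** On an odd board it is better for the protagonist to pick first: the first
    pick is the median. *)
Lemma win_swap_picker m B S : simulation m -> ~~ odd m -> live B S ->
  #|B| = m.+1 -> win (alternating false m) B S -> win (alternating true m) B S.
Proof.
move=> IH m_even BS cB w.
case: (stageP BS) => [Sk|kB|Sk kB].
- by move: w; rewrite !win_overl.
- by case/andP: BS => dBS _; move: w; rewrite !win_overr.
have mE : m = (m./2).*2 by rewrite -{1}(odd_double_half m) (negPf m_even).
have [|x [xB bx ax]] := @ex_median B m./2; first by rewrite cB {1}mE.
move: w; rewrite -(negPf m_even) => w.
have [wP wM] := IH B S BS cB w x xB.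
rewrite (negPf m_even) in wP wM.
case: m cB mE {IH m_even w} bx ax wP wM => [|m] cB mE bx ax wP wM.
  by move: kB; rewrite cB addn1 ltnS leqNgt Sk.
rewrite win_ongoing //; apply/exists_inP; exists x => //.
by rewrite wP ?wM ?bx ?ax.
Qed.

(** The simulation when the game without x is already decided: at most one
    element was left to receive, or everything must be received. *)
Lemma win_give_over m l B S x : live B S -> x \in B ->
  win (alternating (odd m) m) B S -> #|S| < k -> m./2 <= below B x ->
  ~~ (#|S|.+1 < k < #|S| + #|B|) -> win l (B :\ x) (x |: S).
Proof.
move=> BS xB w Sk cb over; have [dBS _] := andP BS.
have xS : x \notin S by rewrite (disjointFr dBS xB).
have [Sk1|Sk1] := eqVneq #|S|.+1 k.
  rewrite win_overl ?cardsU1 ?xS //.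
  by apply: (win_one_left Sk1 dBS xB w); rewrite count_alternating.
have [kB|kB|_ kB] := stageP BS; first by rewrite kB ltnn in Sk.
  have BS' := live_give xB BS Sk.
  rewrite win_overr in w => //.
  rewrite win_overr; last by case/andP: BS'.
    by rewrite -setUA setUCA setD1K.
  by rewrite -kB cardsU1 xS (cardsD1 x B) xB addnCA addnA.
by rewrite ltn_neqAle Sk1 Sk kB in over.
Qed.

(** The same when x is lost: at most one element was left to lose, or nothing
    is left to receive. *)
Lemma win_refuse_over m l B S x : live B S -> x \in B ->
  win (alternating (odd m) m) B S -> k < #|S| + #|B| -> m./2 <= above B x ->
  ~~ ((#|S| < k) && (k.+1 < #|S| + #|B|)) -> win l (B :\ x) S.
Proof.
move=> BS xB w kB ca over; have [dBS _] := andP BS.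
have [kB1|kB1] := eqVneq k.+1 (#|S| + #|B|).
  rewrite win_overr; last by apply: disjointWl dBS; rewrite subsetDl.
    by apply: (win_one_short kB1 dBS xB w); rewrite count_alternating.
  by apply/succn_inj; rewrite kB1 (cardsD1 x B) xB add1n addnS.
have [Sk|kB'|Sk _] := stageP BS; last 2 first.
- by rewrite kB' ltnn in kB.
- by rewrite Sk ltn_neqAle kB1 kB in over.
by move: w; rewrite !win_overl.
Qed.

Lemma win_give_up l B S x y : [disjoint B & S] -> x \in B -> y \in B ->
  x <= y -> win l (B :\ x) (x |: S) -> win l (B :\ y) (y |: S).
Proof.
move=> dBS xB yB; rewrite leq_eqVlt => /predU1P[/val_inj ->//|xy].
have [xS yS] : x \notin S /\ y \notin S.
  by rewrite !(disjointFr dBS).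
have nxy : x != y by rewrite neq_ltn xy.
rewrite -(@setD1K _ y (B :\ x)); last by rewrite !inE eq_sym nxy.
rewrite -(@setD1K _ x (B :\ y)); last by rewrite !inE nxy.
have -> : B :\ y :\ x = B :\ x :\ y by rewrite !setDDl setUC.
by apply: win_swap_up; rewrite // !inE eqxx ?andbF.
Qed.

Lemma win_refuse_down l B S x y : [disjoint B & S] -> x \in B -> y \in B ->
  y <= x -> win l (B :\ x) S -> win l (B :\ y) S.
Proof.
move=> dBS xB yB; rewrite leq_eqVlt => /predU1P[/val_inj ->//|yx].
have [xS yS] : x \notin S /\ y \notin S.
  by rewrite !(disjointFr dBS).
have nxy : x != y by rewrite neq_ltn yx orbT.
rewrite -(@setD1K _ y (B :\ x)); last by rewrite !inE eq_sym nxy.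
rewrite -(@setD1K _ x (B :\ y)); last by rewrite !inE nxy.
have -> : B :\ y :\ x = B :\ x :\ y by rewrite !setDDl setUC.
by apply: win_board_up; rewrite // !inE eqxx ?andbF.
Qed.

Lemma simulationP m : simulation m.
Proof.
elim: m => [|m IHm] B S BS cB w x xB.
  split=> [Sk cb|kB ca].
    apply: (@win_give_over 0) => //.
    rewrite cB addn1 ltnS; apply/negP => /andP[Sk1 /(leq_trans Sk1)].
    by rewrite ltnNge leqnSn.
  apply: (@win_refuse_over 0) => //.
  by rewrite cB addn1 ltnS; case: ltngtP.
have [dBS _] := andP BS.
have nS z : z \in B -> z \notin S
  by move=> zB; rewrite (disjointFr dBS zB).
have cBx z : z \in B -> #|B :\ z| = m.+1.
  by move=> zB; apply/succn_inj; rewrite -cB (cardsD1 z B) zB.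
have Dx z : z \in B -> z != x -> x \in B :\ z.
  by move=> zB zx; rewrite !inE eq_sym zx.
have DC z : B :\ x :\ z = B :\ z :\ x by rewrite !setDDl setUC.
split=> [Sk cb|kB ca].
- case: (boolP (#|S|.+1 < k < #|S| + #|B|)); last first.
    exact: (win_give_over _ BS xB w).
  case/andP=> Sk1 kB.
  have Sx : #|x |: S| < k by rewrite cardsU1 nS.
  have kBx : k < #|x |: S| + #|B :\ x|.
    by move: kB; rewrite cardsU1 nS // (cardsD1 x B) xB addnCA addnA.
  have IH z T : z \in B -> z != x -> live (B :\ z) T -> #|T| < k ->
      m./2 <= below (B :\ z) x -> win (alternating (odd m) m) (B :\ z) T ->
      win (alternating (odd m) m.-1) (B :\ x :\ z) (x |: T).
    move=> zB zx live_T Tk cb' w'; rewrite DC.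
    exact: (IHm _ _ live_T (cBx z zB) w' x (Dx z zB zx)).1 Tk cb'.
  have IHgive z : z \in B -> z != x -> m./2 <= below (B :\ z) x ->
      win (alternating (odd m) m) (B :\ z) (z |: S) ->
      win (alternating (odd m) m.-1) (B :\ x :\ z) (z |: (x |: S)).
    move=> zB zx; rewrite (setUCA [set z]); apply: IH => //.
      exact: live_give.
    by rewrite cardsU1 nS.
  have IHrefuse z : z \in B -> z != x -> m./2 <= below (B :\ z) x ->
      win (alternating (odd m) m) (B :\ z) S ->
      win (alternating (odd m) m.-1) (B :\ x :\ z) (x |: S).
    by move=> zB zx; apply: IH => //; apply: live_refuse.
  have m_gt0 : 0 < m.
    by case: (m) cBx => // cBx; move: kBx; rewrite cBx // addn1 ltnS leqNgt Sx.
  have -> : alternating (odd m.+1) m.+1.-1 =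
      ~~ odd m :: alternating (odd m) m.-1.
    by case: (m) m_gt0 => //= m' _; rewrite !negbK.
  move: w; rewrite [alternating _ _]/= negbK !win_ongoing //.
  case: ifP => [m_even|m_odd].
    case/exists_inP => y yB /andP[w1 w2].
    have [xy|yx] := ltnP x y.
      have yx : y != x by rewrite neq_ltn xy orbT.
      have cb' : m./2 <= below (B :\ y) x.
        by rewrite belowD1_up ?(ltnW xy) // (leq_trans _ cb) // half_leq.
      apply/exists_inP; exists y; first by rewrite !inE yx.
      by rewrite IHgive // IHrefuse.
    (* Let y have been received instead of x, and start afresh from there. *)
    have w1x := win_give_up dBS yB xB yx w1.
    rewrite (negPf m_even) in w1x.
    have := win_swap_picker IHm m_even (live_give xB BS Sk) (cBx x xB) w1x.
    case: (m) m_gt0 m_even => // m' _ m_even.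
    rewrite [alternating _ _]/= win_ongoing //.
    by rewrite (negPf m_even).
  move/forall_inP => h; apply/forall_inP => y; rewrite in_setD1 => /andP[yx yB].
  have cb' : m./2 <= below (B :\ y) x.
    rewrite -ltnS; apply: leq_trans (belowD1_ge B x y); apply: leq_trans cb.
    by rewrite [m.+1./2]/= uphalf_half (negbFE m_odd).
  by case/orP: (h y yB) => [/(IHgive y yB yx cb')|/(IHrefuse y yB yx cb')] ->;
    rewrite ?orbT.
- case: (boolP ((#|S| < k) && (k.+1 < #|S| + #|B|))); last first.
    exact: (win_refuse_over _ BS xB w).
  case/andP=> Sk kB1.
  have kBx : k < #|S| + #|B :\ x|.
    by move: kB1; rewrite (cardsD1 x B) xB addnCA ltnS.
  have IH z T : z \in B -> z != x -> live (B :\ z) T ->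
      k < #|T| + #|B :\ z| -> m./2 <= above (B :\ z) x ->
      win (alternating (odd m) m) (B :\ z) T ->
      win (alternating (odd m) m.-1) (B :\ x :\ z) T.
    move=> zB zx live_T Tk ca' w'; rewrite DC.
    exact: (IHm _ _ live_T (cBx z zB) w' x (Dx z zB zx)).2 Tk ca'.
  have IHgive z : z \in B -> z != x -> m./2 <= above (B :\ z) x ->
      win (alternating (odd m) m) (B :\ z) (z |: S) ->
      win (alternating (odd m) m.-1) (B :\ x :\ z) (z |: S).
    move=> zB zx; apply: IH => //; first exact: live_give.
    by move: kB; rewrite cardsU1 nS // (cardsD1 z B) zB addnCA addnA.
  have IHrefuse z : z \in B -> z != x -> m./2 <= above (B :\ z) x ->
      win (alternating (odd m) m) (B :\ z) S ->
      win (alternating (odd m) m.-1) (B :\ x :\ z) S.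
    move=> zB zx; apply: IH => //; first exact: live_refuse.
    by move: kB1; rewrite (cardsD1 z B) zB addnCA ltnS.
  have m_gt0 : 0 < m.
    case: (m) cBx => // cBx; move: kBx; rewrite cBx // addn1 ltnS leqNgt.
    by rewrite Sk.
  have -> : alternating (odd m.+1) m.+1.-1 =
      ~~ odd m :: alternating (odd m) m.-1.
    by case: (m) m_gt0 => //= m' _; rewrite !negbK.
  move: w; rewrite [alternating _ _]/= negbK !win_ongoing //.
  case: ifP => [m_even|m_odd].
    case/exists_inP => y yB /andP[w1 w2].
    have [yx|xy] := ltnP y x.
      have nyx : y != x by rewrite neq_ltn yx.
      have ca' : m./2 <= above (B :\ y) x.
        by rewrite aboveD1_down ?(ltnW yx) // (leq_trans _ ca) // half_leq.
      apply/exists_inP; exists y; first by rewrite !inE nyx.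
      by rewrite IHgive // IHrefuse.
    (* Let y have been lost instead of x, and start afresh from there. *)
    have w2x := win_refuse_down dBS yB xB xy w2.
    rewrite (negPf m_even) in w2x.
    have := win_swap_picker IHm m_even (live_refuse xB BS kB) (cBx x xB) w2x.
    case: (m) m_gt0 m_even => // m' _ m_even.
    rewrite [alternating _ _]/= win_ongoing //.
    by rewrite (negPf m_even).
  move/forall_inP => h; apply/forall_inP => y; rewrite in_setD1 => /andP[yx yB].
  have ca' : m./2 <= above (B :\ y) x.
    rewrite -ltnS; apply: leq_trans (aboveD1_ge B x y); apply: leq_trans ca.
    by rewrite [m.+1./2]/= uphalf_half (negbFE m_odd).
  by case/orP: (h y yB) => [/(IHgive y yB yx ca')|/(IHrefuse y yB yx ca')] ->;
    rewrite ?orbT.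
Qed.

(** On an even board it is better for the protagonist to choose first. *)
Lemma win_swap_chooser m B S : odd m -> live B S -> #|B| = m.+1 ->
  win (alternating true m) B S -> win (alternating false m) B S.
Proof.
move=> m_odd BS cB w; have [dBS _] := andP BS.
case: (stageP BS) => [Sk|kB|Sk kB].
- by move: w; rewrite !win_overl.
- by move: w; rewrite !win_overr.
case: m m_odd cB w => // m m_even cB.
rewrite ![alternating _ _]/= !win_ongoing //=.
case/exists_inP => x xB /andP[w1 w2].
have cBx : #|B :\ x| = m.+1 by apply/succn_inj; rewrite -cB (cardsD1 x B) xB.
have swap := win_swap_picker (@simulationP m) m_even.
have {}w1 := swap _ _ (live_give xB BS Sk) cBx w1.
have {}w2 := swap _ _ (live_refuse xB BS kB) cBx w2.
apply/forall_inP => y yB; case: (leqP x y) => [xy|/ltnW yx].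
  by rewrite (win_give_up dBS xB yB xy w1).
by rewrite (win_refuse_down dBS xB yB yx w2) orbT.
Qed.

End Game.

(** * The pointwise order and the exchange of elements *)

(** Insertion of x in an increasing sequence. *)
Fixpoint insert (x : nat) (s : seq nat) : seq nat :=
  if s is a :: s' then if x <= a then x :: s else a :: insert x s' else [:: x].

Lemma mem_insert x s : insert x s =i x :: s.
Proof.
elim: s => // a s IHs y /=; case: ifP => _ //.
by rewrite !inE IHs !inE orbCA.
Qed.

Lemma insert_sorted x s : x \notin s -> sorted ltn s -> sorted ltn (insert x s).
Proof.
rewrite !(sorted_pairwise ltn_trans).
elim: s => // a s IHs; rewrite inE negb_or => /andP[xa xs] /= /andP[lt_as srt].
case: leqP => [le_xa|lt_ax] /=.
  rewrite lt_as srt ltn_neqAle xa le_xa !andbT /=.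
  by apply: sub_all lt_as => b; apply: leq_ltn_trans.
by rewrite IHs // (eq_all_r (@mem_insert x s)) /= lt_ax lt_as.
Qed.

Lemma insert_cons_leq a y s : a <= y -> sorted ltn (a :: s) ->
  all2 leq (a :: s) (insert y s).
Proof.
elim: s a => [|b s IHs] a ay; first by rewrite /= ay.
case/andP=> ab srt; rewrite [insert _ _]/=; case: leqP => [yb|lt_by].
  by rewrite /= ay leqnn; elim: (s) => //= c t ->; rewrite leqnn.
by apply/andP; split; [exact: ltnW|apply: IHs (ltnW lt_by) srt].
Qed.

Lemma insert_leq x y s : x <= y -> sorted ltn s ->
  all2 leq (insert x s) (insert y s).
Proof.
move=> xy; elim: s => [|a s IHs] /=; first by rewrite xy.
move=> srt; have refl t : all2 leq t t.
  by elim: t => //= c t ->; rewrite leqnn.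
case: (leqP x a) => [xa|ax].
  case: leqP => [ya|ay] /=; first by rewrite xy leqnn refl.
  by apply/andP; split=> //; apply: insert_cons_leq (ltnW ay) srt.
rewrite leqNgt (leq_trans ax xy) /= leqnn IHs //.
by apply: path_sorted srt.
Qed.

Lemma enum_setU1 (n : nat) (S : {set 'I_n}) (x : 'I_n) : x \notin S ->
  [seq val i | i <- enum (x |: S)] = insert x [seq val i | i <- enum S].
Proof.
move=> xS; apply: (irr_sorted_eq ltn_trans ltnn).
- exact: enum_set_sorted.
- apply: insert_sorted (enum_set_sorted S).
  by rewrite mem_map ?mem_enum //; apply: val_inj.
move=> y; rewrite mem_insert inE.
apply/mapP/idP => [[z + ->]|].
  rewrite mem_enum in_setU1 => /predU1P[->|zS]; first by rewrite eqxx.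
  by rewrite mem_map ?mem_enum ?zS ?orbT //; apply: val_inj.
case/predU1P => [->|/mapP[z zS ->]].
  by exists x; rewrite // mem_enum setU11.
by exists z; rewrite // mem_enum in_setU1 -(mem_enum S) zS orbT.
Qed.

Lemma pointwise_leE (n : nat) (S T : {set 'I_n}) :
  pointwise_le S T =
  all2 leq [seq val i | i <- enum S] [seq val i | i <- enum T].
Proof.
rewrite /pointwise_le; elim: (enum S) (enum T) => [|a s IHs] [|b t] //=.
by rewrite IHs.
Qed.

Lemma increasing_exchange (n k : nat) (F : {set {set 'I_n}}) :
  (forall S : {set 'I_n}, S \in F -> #|S| = k) -> increasing k F ->
  forall (S : {set 'I_n}) (x y : 'I_n), x < y -> x \notin S -> y \notin S ->
  x |: S \in F -> y |: S \in F.
Proof.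
move=> F_ksets F_incr S x y xy xS yS xF; apply: F_incr (xF) _ _.
  by rewrite -(F_ksets _ xF) !cardsU1 xS yS.
rewrite pointwise_leE !enum_setU1 //.
by apply: insert_leq (ltnW xy) (enum_set_sorted S).
Qed.

(** * Strategies and winning positions *)

Section Strategies.

Variables (n k : nat) (F : {set {set 'I_n}}) (p : player).
Hypothesis le_kn : k <= n.
Implicit Types (h : history n) (x : 'I_n) (r : player).

(** The elements still on the board after the history h. *)
Definition board h : {set 'I_n} := [set x | on_board h x].

(** The pickers of the turns that follow the history h, up to the moment when a
    single element is left. *)
Definition turns h : seq bool := alternating (picker h == p) #|board h|.-1.

Lemma player_neq r : (r == opponent p) = (r != p).
Proof. by case: r; case: p. Qed.

Lemma held_cons q h x r :
  held q ((x, r) :: h) = if r == q then x |: held q h else held q h.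
Proof.
apply/setP => y; rewrite !inE xpair_eqE [q == r]eq_sym.
by case: ifP => _; rewrite !inE ?andbT ?andbF.
Qed.

Lemma board_cons h x r : board ((x, r) :: h) = board h :\ x.
Proof. by apply/setP => y; rewrite !inE /on_board /= inE negb_or. Qed.

Lemma picker_cons h x r : (picker ((x, r) :: h) == p) = (picker h != p).
Proof. by rewrite /picker /=; case: odd; case: p. Qed.

Lemma held_opponentC h : uniq (unzip1 h) ->
  ~: held (opponent p) h = held p h :|: board h.
Proof.
move=> uh; apply/setP => x; rewrite !inE /on_board.
elim: h uh => //= -[y r] h IHh /andP[yh /IHh {}IHh].
rewrite !inE !xpair_eqE negb_or IHh negb_or.
have [->|//] := eqVneq x y; rewrite /= [p == r]eq_sym [_ == r]eq_sym player_neq.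
have yq q : (y, q) \in h = false.
  by apply: contraNF yh => /(map_f fst).
by rewrite yh !yq !orbF !andbT /= negbK.
Qed.

Lemma disjoint_board h : [disjoint board h & held p h].
Proof.
rewrite disjoints_subset; apply/subsetP => x; rewrite !inE /on_board.
by apply: contra => /(map_f fst).
Qed.

Lemma game_overE h : uniq (unzip1 h) -> live k (board h) (held p h) ->
  game_over k p h =
    (#|held p h| == k) || (#|held p h| + #|board h| == k).
Proof.
move=> uh /andP[dBS /andP[_ kB]]; rewrite /game_over; congr (_ || _).
have cSB : #|held p h :|: board h| = #|held p h| + #|board h|.
  by rewrite cardsU setIC (disjoint_setI0 dBS) cards0 subn0.
have := cardsC (held (opponent p) h); rewrite held_opponentC // cSB card_ord.
move: (#|held (opponent p) h|) (#|held p h| + #|board h|) kB le_kn => a b; lia.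
Qed.

Lemma win_final l h : uniq (unzip1 h) -> live k (board h) (held p h) ->
  game_over k p h -> win k F l (board h) (held p h) = (final_set k p h \in F).
Proof.
move=> uh BS; rewrite game_overE // /final_set.
have [Sk _|_ /= /eqP SB] := eqVneq; first by rewrite win_overl.
by rewrite held_opponentC // win_overr // disjoint_board.
Qed.

Lemma consistent_live s h : consistent k p s h ->
  uniq (unzip1 h) && live k (board h) (held p h).
Proof.
have step h' x r : uniq (unzip1 h') && live k (board h') (held p h') ->
    ~~ game_over k p h' -> on_board h' x ->
    uniq (unzip1 ((x, r) :: h')) &&
    live k (board ((x, r) :: h')) (held p ((x, r) :: h')).
  case/andP=> uh BS; rewrite game_overE // negb_or => /andP[Sk kB] xh.
  have xB : x \in board h' by rewrite inE.
  apply/andP; split; first by rewrite /= uh andbT.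
  rewrite board_cons held_cons.
  by case: (stageP BS) Sk kB => [->|->|Sk kB _ _]; rewrite ?eqxx //;
    case: ifP => _; rewrite ?live_give ?live_refuse.
elim=> [|h' x r _ IH ov _ xh _|h' x _ IH ov _ xh]; last 2 first.
- exact: step.
- exact: step.
rewrite /live disjoint_board /=.
have -> : held p [::] = set0 :> {set 'I_n} by apply/setP => x; rewrite !inE.
have -> : board [::] = setT by apply/setP => x; rewrite !inE.
by rewrite cards0 cardsT card_ord.
Qed.

Lemma turns_cons h x r : x \in board h -> 1 < #|board h| ->
  turns h = (picker h == p) :: turns ((x, r) :: h).
Proof.
move=> xB; rewrite /turns board_cons picker_cons (cardsD1 x (board h)) xB add1n.
by case: #|_|.
Qed.

(** While the game is not over, at least two elements are on the board, so that
    [turns h] has a first letter. *)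
Lemma win_turns s h : consistent k p s h -> ~~ game_over k p h ->
  win k F (turns h) (board h) (held p h) =
    if picker h == p
    then [exists x in board h,
      win k F (turns ((x, p) :: h)) (board ((x, p) :: h)) (held p ((x, p) :: h))
      && win k F (turns ((x, opponent p) :: h)) (board ((x, opponent p) :: h))
                 (held p ((x, opponent p) :: h))]
    else [forall x in board h,
      win k F (turns ((x, p) :: h)) (board ((x, p) :: h)) (held p ((x, p) :: h))
      || win k F (turns ((x, opponent p) :: h)) (board ((x, opponent p) :: h))
                 (held p ((x, opponent p) :: h))].
Proof.
move=> /consistent_live/andP[uh BS]; rewrite game_overE // negb_or.
case: (stageP BS) => [->|->|Sk kB _]; rewrite ?eqxx ?andbF //.
have cB : 1 < #|board h| by lia.
have turnsE x r : x \in board h -> turns ((x, r) :: h) = behead (turns h).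
  by move=> xB; rewrite (turns_cons r xB cB).
have turnsE' : turns h = (picker h == p) :: behead (turns h).
  have /card_gt0P[x xB] : 0 < #|board h| by apply: ltnW.
  by rewrite (turns_cons p xB cB).
have heldE x : held p ((x, p) :: h) = x |: held p h by rewrite held_cons eqxx.
have heldE' x : held p ((x, opponent p) :: h) = held p h.
  by rewrite held_cons; case: p.
rewrite {1}turnsE' win_ongoing //; case: ifP => _.
  apply: eq_existsb => x; case: (boolP (x \in board h)) => //= xB.
  by rewrite !turnsE // !board_cons heldE heldE'.
apply: eq_forallb => x; case: (boolP (x \in board h)) => //= xB.
by rewrite !turnsE // !board_cons heldE heldE'.
Qed.

Lemma winning_win s h : winning k F p s -> consistent k p s h ->
  win k F (turns h) (board h) (held p h).
Proof.
move=> [leg fin]; have [m] := ubnP #|board h|.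
elim: m h => // m IHm h lt_m con_h.
have [uh BS] := andP (consistent_live con_h).
have [ov|ongoing] := boolP (game_over k p h).
  by rewrite win_final // fin.
have IH x r : x \in board h -> consistent k p s ((x, r) :: h) ->
    win k F (turns ((x, r) :: h)) (board ((x, r) :: h)) (held p ((x, r) :: h)).
  move=> xB; apply: IHm; rewrite board_cons -ltnS.
  by move: lt_m; rewrite (cardsD1 x (board h)) xB.
rewrite (win_turns con_h ongoing); case: eqP => [pick_p|/eqP pick_p].
  have [x pick_x xh] := leg h con_h ongoing pick_p.
  have xB : x \in board h by rewrite inE.
  apply/exists_inP; exists x => //.
  by rewrite !IH //; apply: consistent_picker.
apply/forall_inP => x xB; have xh : on_board h x by rewrite inE in xB.
have pick_o : picker h = opponent p by apply/eqP; rewrite player_neq.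
have := IH x _ xB
  (@consistent_chooser n k p s h x con_h ongoing pick_o xh).
have [->->//|] := eqVneq (Defs.choose s h x) p.
by rewrite -player_neq => /eqP -> ->; rewrite orbT.
Qed.

(** The strategy of moving to a winning position whenever there is one. *)
Definition win_strategy : strategy n := Strategy
  (fun h => [pick x in board h |
     win k F (turns ((x, p) :: h)) (board ((x, p) :: h)) (held p ((x, p) :: h))
     && win k F (turns ((x, opponent p) :: h)) (board ((x, opponent p) :: h))
                (held p ((x, opponent p) :: h))])
  (fun h x =>
     if win k F (turns ((x, p) :: h)) (board ((x, p) :: h))
          (held p ((x, p) :: h)) then p else opponent p).

Lemma win_strategy_keeps h :
  win k F (turns [::]) (board [::]) (held p [::]) ->
  consistent k p win_strategy h -> win k F (turns h) (board h) (held p h).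
Proof.
move=> w0; elim=> // {}h x.
  move=> r con_h IH ongoing pick_p xh /=.
  case: pickP => // y /andP[yB /andP[w1 w2]] [<-].
  have [->//|] := eqVneq r p.
  by rewrite -player_neq => /eqP ->.
move=> con_h IH ongoing pick_o xh.
move: IH; rewrite (win_turns con_h ongoing) pick_o eq_sym player_neq eqxx /=.
move=> /forall_inP/(_ x); rewrite inE => /(_ xh).
by case: ifP.
Qed.

Lemma wins_own_gameE :
  wins_own_game k F p <->
  win k F (alternating (p == Alice) n.-1) [set: 'I_n] set0.
Proof.
have start : win k F (turns [::]) (board [::]) (held p [::]) =
    win k F (alternating (p == Alice) n.-1) [set: 'I_n] set0.
  have -> : held p [::] = set0 :> {set 'I_n} by apply/setP => x; rewrite !inE.
  rewrite /turns; have -> : board [::] = setT by apply/setP => x; rewrite !inE.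
  by rewrite cardsT card_ord eq_sym.
rewrite -start; split=> [[s win_s]|w0].
  exact: winning_win win_s (consistent_start _ _ _).
exists win_strategy; split=> [h con_h ongoing pick_p|h con_h ov].
  have := win_strategy_keeps w0 con_h.
  rewrite (win_turns con_h ongoing) pick_p eqxx => /exists_inP[x xB w].
  rewrite /=; case: pickP => [y /andP[yB _]|/(_ x)]; last by rewrite xB w.
  by exists y => //; rewrite inE in yB.
have [uh BS] := andP (consistent_live con_h).
by rewrite -(win_final (turns h)) // win_strategy_keeps.
Qed.

End Strategies.

Theorem theorem1p2 (n k : nat) (F : {set {set 'I_n}})
    (le_kn : k <= n)
    (F_ksets : forall S : {set 'I_n}, S \in F -> #|S| = k)
    (F_incr : increasing k F) :
  (~~ odd n -> wins_own_game k F Alice -> wins_own_game k F Bob) /\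
  (odd n -> wins_own_game k F Bob -> wins_own_game k F Alice).
Proof.
have exch := increasing_exchange F_ksets F_incr.
rewrite !wins_own_gameE //=.
have live0 : live k [set: 'I_n] set0.
  by rewrite /live disjoints_subset setC0 subxx cards0 cardsT card_ord.
have cT m : n.-1 = m -> 0 < n -> #|[set: 'I_n]| = m.+1.
  by move=> <- n_gt0; rewrite cardsT card_ord prednK.
have [n0|n_gt0] := posnP n; first by have -> : n.-1 = 0 by rewrite n0.
have parity : odd n = ~~ odd n.-1 by rewrite -{1}(prednK n_gt0).
split; rewrite parity ?negbK => odd_n.
  exact: (win_swap_chooser exch odd_n live0 (cT _ erefl n_gt0)).
exact: (win_swap_picker (simulationP exch (m := n.-1)) odd_n live0
  (cT _ erefl n_gt0)).
Qed.
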